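(* Let $\mathbb{F}$ be a field of characteristic $0$, let $V$ be a vector space over $\mathbb{F}$, and let $(\mathsf{J}_k)_{k\in\mathbb{Z}}$ be a collection of linear operators $\mathsf{J}_k:V\to V$ such that (H) $\mathsf{J}_k\circ\mathsf{J}_l-\mathsf{J}_l\circ\mathsf{J}_k=k\,\delta_{k,-l}\,\mathrm{id}_V$ for all $k,l\in\mathbb{Z}$; (T) for every $v\in V$ there exists $K_v\in\mathbb{Z}$ such that $\mathsf{J}_l v=0$ for all $l\ge K_v$. For $n\in\mathbb{Z}$ let $\mathsf{L}_n:V\to V$ be the linear operator $$\mathsf{L}_n v=\frac12\sum_{k\in\mathbb{Z}}{:}\mathsf{J}_{n-k}\mathsf{J}_k{:}\,v\qquad (v\in V).$$ Then for all $m,n\in\mathbb{Z}$, $$\mathsf{L}_m\circ\mathsf{L}_n-\mathsf{L}_n\circ\mathsf{L}_m=(m-n)\,\mathsf{L}_{m+n}+\frac{m^3-m}{12}\,\delta_{m,-n}\,\mathrm{id}_V.$$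
   Context: The normal ordered product is ${:}\mathsf{J}_k\mathsf{J}_l{:}=\mathsf{J}_k\circ\mathsf{J}_l$ if $k\le l$, and ${:}\mathsf{J}_k\mathsf{J}_l{:}=\mathsf{J}_l\circ\mathsf{J}_k$ if $k>l$. For each fixed $v\in V$ the sum defining $\mathsf{L}_n v$ has only finitely many nonzero terms by (T), and it is understood as that finite sum. $\delta$ is the Kronecker delta. *)

(* Defs.v *)
From mathcomp Require Import all_boot all_order all_algebra.
From mathcomp Require Import finmap all_classical.
From mathcomp Require Import zify.

Set Implicit Arguments.
Unset Strict Implicit.
Unset Printing Implicit Defensive.

Import Order.TTheory GRing.Theory Num.Theory.
Local Open Scope classical_set_scope.
Local Open Scope ring_scope.

Definition kronecker (F : fieldType) (i j : int) : F := (i == j)%:R.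

Definition normal_ordered (F : fieldType) (V : lmodType F)
    (J : int -> {linear V -> V}) (k l : int) : V -> V :=
  if k <= l then J k \o J l else J l \o J k.

Definition heisenberg (F : fieldType) (V : lmodType F)
    (J : int -> {linear V -> V}) : Prop :=
  forall (k l : int) (v : V),
    J k (J l v) - J l (J k v) = (k%:~R * kronecker F k (- l)) *: v.

Definition locally_truncated (F : fieldType) (V : lmodType F)
    (J : int -> {linear V -> V}) : Prop :=
  forall v : V, exists K : int, forall l : int, K <= l -> J l v = 0.

(* The finitely supported sum is 0 by convention when the support is infinite;
   [sugawara_support] shows that this never happens under
   [locally_truncated J]. *)
Definition sugawara (F : fieldType) (V : lmodType F)
    (J : int -> {linear V -> V}) (n : int) (v : V) : V :=
  2%:R^-1 *: \sum_(k \in [set: int]) normal_ordered J (n - k) k v.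

Lemma sugawara_support (F : fieldType) (V : lmodType F)
    (J : int -> {linear V -> V}) (n : int) (v : V) :
  locally_truncated J ->
  finite_set [set k : int | normal_ordered J (n - k) k v != 0].
Proof.
move=> /(_ v)[K JK].
pose N := (absz n + absz K)%N.
pose s : seq int := [seq i%:Z - N%:Z | i <- iota 0 (N + N).+1].
apply: (@sub_finite_set _ _ [set` s]); last exact: finite_seq.
move=> k /=; rewrite /normal_ordered => nz.
have [kN Nk] : k <= N%:Z /\ - N%:Z <= k.
  case: ifP nz => /= nkk nz.
    have kK : k < K by rewrite ltNge; apply: contra nz => /JK ->; rewrite linear0.
    by rewrite /N; split; lia.
  have kK : n - k < K.
    by rewrite ltNge; apply: contra nz => /JK ->; rewrite linear0.
  by rewrite /N; split; lia.
apply/mapP; exists (absz (k + N%:Z)); last by lia.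
by rewrite mem_iota; lia.
Qed.

Lemma sugawara_linear (F : fieldType) (V : lmodType F)
    (J : int -> {linear V -> V}) (n : int) :
  locally_truncated J -> linear (sugawara J n).
Proof.
move=> TJ a u v; rewrite /sugawara.
pose f w k := normal_ordered J (n - k) k w.
have fin w : finite_set [set k | f w k != 0] by exact: sugawara_support.
have [s fs] : exists s : {fset int},
    forall w, w \in [:: u; v; a *: u + v] -> forall k, k \notin s -> f w k = 0.
  exists (fset_set ([set k | f u k != 0] `|` [set k | f v k != 0]
    `|` [set k | f (a *: u + v) k != 0])) => w ws k.
  rewrite in_fset_set; last by rewrite !finite_setU.
  move=> /negP; rewrite inE /= => nk; apply/eqP/negPn/negP => fk; apply: nk.
  by move: ws fk; rewrite !inE => /or3P[] /eqP -> fk; [left; left|left; right|right].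
have sumE w : w \in [:: u; v; a *: u + v] ->
    \sum_(k \in [set: int]) normal_ordered J (n - k) k w = \sum_(k <- s) f w k.
  move=> /fs ws; apply: fsbigTE => k; exact: ws.
rewrite !sumE ?inE ?eqxx ?orbT// !scaler_sumr -big_split /=.
apply: eq_bigr => k _.
have -> : f (a *: u + v) k = a *: f u k + f v k.
  by rewrite /f /normal_ordered; case: ifP => _; rewrite /= !linearP.
by rewrite scalerDr !scalerA mulrC.
Qed.

(* Main.v *)
Require Import Defs.
From mathcomp Require Import all_boot all_order all_algebra.
From mathcomp Require Import finmap all_classical zify ring.

(** The Sugawara construction for one free boson.  Three observations carry the
    proof.

    Reordering J_(n-k) J_k matters only when n = 0, since the two modes commute
    otherwise; and for n = 0 the rule n - k <= k says 0 <= k.  So the k-th term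
    of L_n may be ordered by the sign of k alone ([normal_orderedE]), a rule
    that behaves well when k is shifted.

    Every mode is primary of weight one: [L_n, J_l] = - l J_(n+l)
    ([sugawara_comm_mode]), because commuting J_l through the sum leaves the
    contributions of k = -l and k = n + l only.  By the Leibniz rule, [L_m, .]
    sends the k-th term of L_n to (k - n) times the k-th term of L_(m+n), minus
    k times its (m+k)-th term, except that the second of these may come out in
    the wrong order.  Putting it right costs a multiple of the identity,
    supported on m + n = 0 ([sugawara_comm_normal_ordered]).

    Each of the three families is finitely supported on a given vector, so they
    may be summed separately and the second one shifted by m.  The first two
    then add up to sum_k (m - n) :J_(m+n-k) J_k: = 2 (m - n) L_(m+n).  The last
    one is the sum of k (m + k) over the k where [0 <= k] and [0 <= m + k]
    differ, with sign; telescoping gives (m^3 - m) / 6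
    ([fsum_central_defect]). *)

Set Implicit Arguments.
Unset Strict Implicit.
Unset Printing Implicit Defensive.

Import Order.TTheory GRing.Theory Num.Theory.
Local Open Scope ring_scope.

(** * Finitely supported sums over the integers *)

Definition finitely_supported (U : zmodType) (f : int -> U) : Prop :=
  finite_set [set k | f k != 0]%classic.

Local Notation "\fsum_ k F" := (\sum_(k \in [set: int]%classic) F)
  (at level 41, k name, F at level 41).

Section FiniteSums.
Variables U W : zmodType.
Implicit Types f g h : int -> U.

Lemma finitely_supported_fset f : finitely_supported f ->
  exists s : {fset int}, forall k, k \notin s -> f k = 0.
Proof.
move=> ff; exists (fset_set [set k | f k != 0]%classic) => k.
by rewrite in_fset_set // notin_setE /= => /negP; rewrite negbK => /eqP.
Qed.

Lemma finitely_supported_sub f (g : int -> W) : finitely_supported f ->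
  (forall k, f k = 0 -> g k = 0) -> finitely_supported g.
Proof.
move=> ff fg; apply: sub_finite_set ff => k /=.
by apply: contra => /eqP/fg ->.
Qed.

Lemma finitely_supportedD f g : finitely_supported f -> finitely_supported g ->
  finitely_supported (fun k => f k + g k).
Proof.
move=> ff fg.
have : finite_set ([set k | f k != 0] `|` [set k | g k != 0])%classic
  by rewrite finite_setU.
apply: sub_finite_set => k /=; have [f0|f0 _] := eqVneq (f k) 0; last by left.
by rewrite f0 add0r; right.
Qed.

Lemma finitely_supported_bounded f (a b : int) :
  (forall k, k < a \/ b <= k -> f k = 0) -> finitely_supported f.
Proof.
move=> f0; pose s := [seq a + i%:Z | i <- iota 0 (absz (b - a))].
apply: (@sub_finite_set _ _ [set` s]%classic); last exact: finite_seq.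
move=> k /= nz; have kab : a <= k < b.
  by apply: contraNT nz => ?; apply/eqP/f0; lia.
apply/mapP; exists (absz (k - a)); last by lia.
by rewrite mem_iota; lia.
Qed.

Lemma finitely_supported_shift f (a : int) : finitely_supported f ->
  finitely_supported (fun k => f (a + k)).
Proof.
move=> ff.
apply: (@sub_finite_set _ _ ((fun k => k - a) @` [set k | f k != 0])%classic).
  by move=> k /= fk; exists (a + k) => //=; lia.
exact: finite_image.
Qed.

Lemma finitely_supported_delta (a : int) (u : U) :
  finitely_supported (fun k => if k == a then u else 0).
Proof.
by apply: (@finitely_supported_bounded _ a (a + 1)) => k; case: eqP => //; lia.
Qed.

Lemma fsumD f g : finitely_supported f -> finitely_supported g ->
  \fsum_k (f k + g k) = \fsum_k f k + \fsum_k g k.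
Proof.
move=> /finitely_supported_fset[s fs] /finitely_supported_fset[t gt].
have sub h : (forall k, k \notin s -> k \notin t -> h k = 0 :> U) ->
    \fsum_k h k = \sum_(k <- (s `|` t)%fset) h k.
  move=> h0; apply: fsbigTE => k.
  by rewrite inE negb_or => /andP[? ?]; apply: h0.
by rewrite !sub ?big_split //= => k /fs fk /gt gk; rewrite ?fk ?gk ?addr0.
Qed.

Lemma fsum_morph (phi : U -> W) f : {morph phi : x y / x + y} ->
  finitely_supported f -> phi (\fsum_k f k) = \fsum_k phi (f k).
Proof.
move=> phiD /finitely_supported_fset[s fs].
have phi0 : phi 0 = 0 by apply: (addrI (phi 0)); rewrite -phiD !addr0.
rewrite !(@fsbigTE _ _ _ _ s) // => [|k /fs -> //].
exact: (big_morph phi phiD phi0).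
Qed.

Lemma fsum_shift f (a : int) : \fsum_k f (a + k) = \fsum_k f k.
Proof.
apply/esym/reindex_fsbigT; exists (fun k => k - a) => k; lia.
Qed.

Lemma fsum_delta (a : int) (u : U) : \fsum_k (if k == a then u else 0) = u.
Proof.
rewrite (@fsbigTE _ _ _ _ [fset a]%fset) ?big_seq_fset1 ?eqxx // => k.
by rewrite inE => /negPf ->.
Qed.

(** Telescoping over all of the integers: the increments of a finitely
    supported [h] sum to zero by shift invariance.  The two isolated terms make
    room for an [h] cut off by sign conditions, which jumps at the cuts. *)
Lemma fsum_difference h f (a b : int) (u w : U) :
  finitely_supported h -> finitely_supported f ->
  (forall k, h (1 + k) = h k + (f k +
     ((if k == a then u else 0) + (if k == b then w else 0)))) ->
  \fsum_k f k = - (u + w).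
Proof.
move=> fh ff stepE.
have [fa fb] := (finitely_supported_delta a u, finitely_supported_delta b w).
have fab := finitely_supportedD fa fb.
have := fsum_shift h 1; under eq_fsbigr => k _ do rewrite stepE.
rewrite (fsumD fh (finitely_supportedD ff fab)) (fsumD ff fab) (fsumD fa fb).
rewrite (fsum_delta a u) (fsum_delta b w) addrC => /eqP.
by rewrite -subr_eq0 addrK addr_eq0 => /eqP.
Qed.

End FiniteSums.

(** * The central term *)

(** The scalar produced when [L_m, .] hits the k-th term of L_(-m) and the
    result is put back in normal order: that term is ordered by the sign of k,
    the one it turns into by the sign of m + k. *)
Definition central_defect (m k : int) : int :=
  k * (m + k) * ((0 <= k)%R%:R - (0 <= m + k)%R%:R).

Lemma finitely_supported_central_defect m :
  finitely_supported (central_defect m).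
Proof.
apply: (@finitely_supported_bounded _ _ (- `|m|) `|m|) => k ?.
rewrite /central_defect.
have -> : (0 <= k) = (0 <= m + k) by lia.
by rewrite subrr mulr0.
Qed.

(** Using a discrete antiderivative of 6 k (m + k) avoids any case distinction
    on the sign of m. *)
Lemma fsum_central_defect (m : int) :
  (\fsum_k central_defect m k) *+ 6 = m ^+ 3 - m.
Proof.
(* Q (1 + k) - Q k = 6 k (m + k) *)
pose Q (k : int) : int := k * (k - 1) * (k *+ 2 - 1 + m *+ 3).
pose h (k : int) : int := Q k * ((0 <= k)%R%:R - (0 <= m + k)%R%:R).
have fh : finitely_supported h.
  apply: (@finitely_supported_bounded _ _ (- `|m|) `|m|) => k ?.
  rewrite /h; have -> : (0 <= k) = (0 <= m + k) by lia.
  by rewrite subrr mulr0.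
have stepE k : h (1 + k) = h k + (central_defect m k *+ 6
    + ((if k == -1 then Q 0 else 0)
       + (if k == - m - 1 then - Q (- m) else 0))).
  have E1 : (0 <= 1 + k)%R%:R = (k == -1)%R%:R + (0 <= k)%R%:R :> int.
    by case: eqP; lia.
  have E2 : (0 <= m + (1 + k))%R%:R
      = (k == - m - 1)%R%:R + (0 <= m + k)%R%:R :> int.
    by case: eqP; lia.
  have -> : (if k == -1 then Q 0 else 0) = (k == -1)%R%:R * Q (1 + k).
    by case: eqP => [->|_]; rewrite ?mul1r ?mul0r.
  have -> : (if k == - m - 1 then - Q (- m) else 0)
      = - (k == - m - 1)%R%:R * Q (1 + k).
    case: eqP => [->|_]; rewrite ?oppr0 ?mul0r // mulN1r.
    by congr (- Q _); ring.
  by rewrite /h E1 E2 /central_defect /Q; ring.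
have f6 : finitely_supported (fun k => central_defect m k *+ 6).
  apply: finitely_supported_sub (finitely_supported_central_defect m) _.
  by move=> k ->; rewrite mul0rn.
rewrite (fsum_morph (phi := fun x : int => x *+ 6)); first last.
- exact: finitely_supported_central_defect.
- by move=> x y; rewrite mulrnDl.
by rewrite (fsum_difference fh f6 stepE) /Q; ring.
Qed.

(** * Commutators of the Sugawara operators *)

Section Sugawara.
Variables (F : fieldType) (V : lmodType F) (J : int -> {linear V -> V}).
Hypotheses (JH : heisenberg J) (JT : locally_truncated J).

(** For n = 0 both rules are the same inequality; for n != 0 the modes
    commute. *)
Lemma normal_orderedE (n k : int) (v : V) :
  normal_ordered J (n - k) k v =
  if 0 <= k then J (n - k) (J k v) else J k (J (n - k) v).
Proof.
have [n0|n0] := eqVneq n 0.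
  rewrite /normal_ordered; have -> : (n - k <= k) = (0 <= k) by lia.
  by case: ifP.
have JC : J (n - k) (J k v) = J k (J (n - k) v).
  apply/eqP; rewrite -subr_eq0 JH /kronecker.
  have /negPf -> : n - k != - k by lia.
  by rewrite mulr0 scale0r.
by rewrite /normal_ordered /= -JC !if_same; case: ifP => _ /=.
Qed.

Lemma finitely_supported_normal_ordered n v :
  finitely_supported (fun k => normal_ordered J (n - k) k v).
Proof. exact: sugawara_support. Qed.

Lemma fsum_normal_ordered n v : 2%:R != 0 :> F ->
  \fsum_k normal_ordered J (n - k) k v = 2%:R *: sugawara J n v.
Proof. by move=> two_neq0; rewrite /sugawara scalerA mulfV // scale1r. Qed.

Lemma sugawaraD n : {morph sugawara J n : x y / x + y}.
Proof. by move=> x y; have := sugawara_linear n JT 1 x y; rewrite !scale1r. Qed.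

Lemma sugawaraZ n a x : sugawara J n (a *: x) = a *: sugawara J n x.
Proof.
have s0 : sugawara J n 0 = 0.
  by apply: (addrI (sugawara J n 0)); rewrite -sugawaraD !addr0.
by have := sugawara_linear n JT a x 0; rewrite s0 !addr0.
Qed.

Lemma quadratic_comm (a b l : int) (v : V) :
  J a (J b (J l v)) - J l (J a (J b v)) =
  (b%:~R * kronecker F b (- l)) *: J a v +
  (a%:~R * kronecker F a (- l)) *: J b v.
Proof. by rewrite -[in RHS]linearZ -!JH linearB /= addrA subrK. Qed.

(** The commutator of J_l with a product of two modes is the same for both
    orders of the product, so normal ordering has no effect here.  The terms
    k = -l and k = n + l contribute - l J_(n+l) each, which cancels the factor
    1/2. *)
Lemma sugawara_comm_mode (two_neq0 : 2%:R != 0 :> F) (n l : int) (v : V) :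
  sugawara J n (J l v) - J l (sugawara J n v) = (- l)%:~R *: J (n + l) v.
Proof.
pose c := (- l)%:~R *: J (n + l) v.
have termE k : normal_ordered J (n - k) k (J l v)
      + - J l (normal_ordered J (n - k) k v) =
    (if k == - l then c else 0) + (if k == n + l then c else 0).
  have -> : (k == n + l) = (n - k == - l) by lia.
  transitivity ((k%:~R * kronecker F k (- l)) *: J (n - k) v +
    ((n - k)%:~R * kronecker F (n - k) (- l)) *: J k v).
    rewrite !normal_orderedE; case: ifP => _; rewrite quadratic_comm //.
    by rewrite addrC.
  rewrite /kronecker; congr (_ + _).
    case: eqP => [->|_]; last by rewrite mulr0 scale0r.
    by rewrite mulr1 opprK.
  case: eqP => [nk|_]; last by rewrite mulr0 scale0r.
  by rewrite mulr1 nk /c; congr (_ *: J _ v); lia.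
have fN w := finitely_supported_normal_ordered n w.
have JNmorph : {morph (fun x => - J l x) : x y / x + y}.
  by move=> x y; rewrite linearD opprD.
have fJ : finitely_supported (fun k => - J l (normal_ordered J (n - k) k v)).
  by apply: finitely_supported_sub (fN v) _ => k ->; rewrite linear0 oppr0.
rewrite /sugawara linearZ /= -scalerN (fsum_morph JNmorph (fN v)) -scalerDr.
rewrite -(fsumD (fN _) fJ); under eq_fsbigr => k _ do rewrite termE.
rewrite (fsumD (finitely_supported_delta _ _) (finitely_supported_delta _ _)).
by rewrite !fsum_delta -mulr2n -scaler_nat scalerA mulVf // scale1r.
Qed.

Lemma sugawara_comm_quadratic (two_neq0 : 2%:R != 0 :> F) (m a b : int) (v : V) :
  sugawara J m (J a (J b v)) - J a (J b (sugawara J m v)) =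
  (- a)%:~R *: J (m + a) (J b v) + (- b)%:~R *: J a (J (m + b) v).
Proof.
rewrite -(sugawara_comm_mode two_neq0) -linearZ /=.
by rewrite -(sugawara_comm_mode two_neq0) linearB /= addrA subrK.
Qed.

(** Of the two products given by the Leibniz rule, the one that still contains
    J_k is ordered by the sign of k, as the k-th term of L_(m+n) requires.  The
    other, made of J_(n-k) and J_(m+k), should follow the sign of m + k but
    inherits that of k; it needs reordering when these signs differ. *)
Lemma sugawara_comm_normal_ordered (two_neq0 : 2%:R != 0 :> F)
    (m n k : int) (v : V) :
  sugawara J m (normal_ordered J (n - k) k v)
    - normal_ordered J (n - k) k (sugawara J m v) =
  (k - n)%:~R *: normal_ordered J (m + n - k) k v
  + (- k)%:~R *: normal_ordered J (m + n - (m + k)) (m + k) v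
  + (central_defect m k)%:~R *: (kronecker F m (- n) *: v).
Proof.
have JC : J (n - k) (J (m + k) v) =
    (- (m + k)%:~R * kronecker F m (- n)) *: v + J (m + k) (J (n - k) v).
  apply/eqP; rewrite -subr_eq JH; apply/eqP; congr (_ *: _).
  have -> : kronecker F (n - k) (- (m + k)) = kronecker F m (- n).
    by rewrite /kronecker; congr (_ %:R); congr nat_of_bool; lia.
  rewrite /kronecker; case: eqP => [->|_]; last by rewrite !mulr0.
  by rewrite -mulrNz; congr (_%:~R * _); lia.
rewrite !normal_orderedE /central_defect.
have -> : m + n - (m + k) = n - k by lia.
have -> : m + n - k = m + (n - k) by lia.
have [k0|k0] := boolP (0 <= k); have [mk0|mk0] := boolP (0 <= m + k);
  rewrite sugawara_comm_quadratic // ?opprB ?JC ?subrr ?mulr0 ?scale0r ?addr0 //.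
- rewrite scalerDr [X in _ + X]addrC addrA; congr (_ + _).
  rewrite !scalerA mulr1; congr (_ *: v).
  by rewrite !intrM !mulrNz; ring.
- rewrite scalerDr addrC -[RHS]addrA; congr (_ + _).
  rewrite addrAC -[LHS]add0r; congr (_ + _).
  rewrite !scalerA -scalerDl -[LHS](scale0r v); congr (_ *: v).
  by rewrite sub0r mulrN1 !mulrNz intrM; ring.
- exact: addrC.
Qed.

End Sugawara.

(** * The Virasoro relation *)

Theorem theorem10p1 (F : fieldType) (F_char0 : [pchar F] =i pred0)
    (V : lmodType F) (J : int -> {linear V -> V})
    (JH : heisenberg J) (JT : locally_truncated J) (m n : int) (v : V) :
  sugawara J m (sugawara J n v) - sugawara J n (sugawara J m v) =
  (m - n)%:~R *: sugawara J (m + n) v +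
  ((m ^+ 3 - m)%:~R / 12%:R * kronecker F m (- n)) *: v.
Proof.
have natF := (pcharf0P F).1 F_char0.
have two_neq0 : 2%:R != 0 :> F by rewrite natF.
pose N (l k : int) w := normal_ordered J (l - k) k w.
have fN l w : finitely_supported (fun k => N l k w).
  exact: finitely_supported_normal_ordered.
(* By the commutator formula, the k-th summand is f k + g (m + k) + h k; in g
   the shift by m has been undone. *)
pose f k := (k - n)%:~R *: N (m + n) k v.
pose g k := (m - k)%:~R *: N (m + n) k v.
pose h k := (central_defect m k)%:~R *: (kronecker F m (- n) *: v).
have ff : finitely_supported f.
  apply: finitely_supported_sub (fN (m + n) v) _ => k.
  by rewrite /f => ->; rewrite scaler0.
have fg : finitely_supported g.
  apply: finitely_supported_sub (fN (m + n) v) _ => k.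
  by rewrite /g => ->; rewrite scaler0.
have fgm := finitely_supported_shift m fg.
have fc := finitely_supported_central_defect m.
have fh : finitely_supported h.
  by apply: finitely_supported_sub fc _ => k; rewrite /h => ->; rewrite scale0r.
have comm : sugawara J m (sugawara J n v) - sugawara J n (sugawara J m v) =
    2%:R^-1 *: (\fsum_k f k + \fsum_k g (m + k) + \fsum_k h k).
  have fL : finitely_supported (fun k => sugawara J m (N n k v)).
    apply: finitely_supported_sub (fN n v) _ => k ->.
    by have := sugawaraZ JT m 0 0; rewrite !scale0r.
  have fM : finitely_supported (fun k => - N n k (sugawara J m v)).
    apply: finitely_supported_sub (fN n (sugawara J m v)) _ => k ->.
    by rewrite oppr0.
  rewrite {2}/sugawara sugawaraZ // (fsum_morph (sugawaraD JT m) (fN n v)).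
  rewrite {2}/sugawara -scalerN (fsum_morph (@opprD V) (fN n _)) -scalerDr.
  rewrite -fsumD // -fsumD // -fsumD //; last exact: finitely_supportedD.
  congr (_ *: _); apply: eq_fsbigr => k _.
  rewrite sugawara_comm_normal_ordered // /f /g /h /N.
  by congr (_ + _%:~R *: _ + _); lia.
have sumfg : \fsum_k f k + \fsum_k g (m + k)
    = 2%:R *: ((m - n)%:~R *: sugawara J (m + n) v).
  rewrite fsum_shift -fsumD // scalerA mulrC -scalerA -fsum_normal_ordered //.
  rewrite (fsum_morph (phi := fun x : V => (m - n)%:~R *: x)); last exact: fN.
    apply: eq_fsbigr => k _; rewrite /f /g -scalerDl -rmorphD.
    by congr (_%:~R *: _); lia.
  by move=> x y; rewrite scalerDr.
have sumh : \fsum_k h k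
    = (\fsum_k central_defect m k)%:~R *: (kronecker F m (- n) *: v).
  pose phi (z : int) := z%:~R *: (kronecker F m (- n) *: v).
  symmetry; apply: (fsum_morph (phi := phi)) => //.
  by move=> x y; rewrite /phi rmorphD scalerDl.
rewrite comm sumfg sumh scalerDr (scalerA 2%:R^-1) mulVf // scale1r.
congr (_ + _); rewrite !scalerA -(fsum_central_defect m) rmorphMn /=.
congr (_ *: v); field.
by rewrite !natF.
Qed.
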